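(* Let $p\ge 3$ be a prime. Every finite metacyclic $p$-group $S$ is resistant, i.e. for every saturated fusion system $\mathcal F$ over $S$ one has $N_{\mathcal F}(S)=\mathcal F$.
   Context: A fusion system $\mathcal F$ over a finite $p$-group $S$ is a category whose objects are the subgroups of $S$, with $\mathrm{Hom}_S(P,Q)\subseteq \mathrm{Hom}_{\mathcal F}(P,Q)\subseteq \mathrm{Inj}(P,Q)$ (where $\mathrm{Hom}_S(P,Q)$ denotes maps induced by conjugation in $S$), and such that every morphism is an $\mathcal F$-isomorphism followed by an inclusion. $P,Q\le S$ are $\mathcal F$-conjugate if they are isomorphic in $\mathcal F$. $P\le S$ is fully centralized (resp. fully normalized) if $|C_S(P)|\ge|C_S(P')|$ (resp. $|N_S(P)|\ge |N_S(P')|$) for all $P'$ $\mathcal F$-conjugate to $P$. $\mathcal F$ is saturated if (I) every fully normalized $P$ is fully centralized and $\mathrm{Aut}_S(P)\in \mathrm{Syl}_p(\mathrm{Aut}_{\mathcal F}(P))$; (II) if $\varphi\in \mathrm{Hom}_{\mathcal F}(P,S)$ has $\varphi P$ fully centralized, then $\varphi$ extends to a morphism in $\mathrm{Hom}_{\mathcal F}(N_\varphi,S)$, where $N_\varphi=\{g\in N_S(P)\mid \varphi c_g\varphi^{-1}\in \mathrm{Aut}_S(\varphi P)\}$. The condition $N_{\mathcal F}(S)=\mathcal F$ means that every $\varphi\in\mathrm{Hom}_{\mathcal F}(Q,Q')$, for all $Q,Q'\le S$, is the restriction of some $\psi\in\mathrm{Aut}_{\mathcal F}(S)$. A $p$-group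 $S$ is resistant if this holds for every saturated fusion system over $S$. *)

(* Defs.v *)
From mathcomp Require Import all_boot all_fingroup all_solvable.

Set Implicit Arguments.
Unset Strict Implicit.
Unset Printing Implicit Defensive.

Local Open Scope group_scope.

(** A map out of a subgroup [P] of the ambient finite group is encoded as an
    [{ffun gT -> gT}] with value [1] outside [P].  Homomorphisms with domain
    [P] thus have a unique representative, and composition of injective
    homomorphisms is composition of finite functions, as they fix [1]. *)

Section Maps.

Variable gT : finGroupType.
Implicit Types (P Q S : {group gT}) (f g phi : {ffun gT -> gT}).

Definition restrF (P : {set gT}) (h : gT -> gT) : {ffun gT -> gT} :=
  [ffun x => if x \in P then h x else 1].

Definition idF (P : {set gT}) : {ffun gT -> gT} := restrF P id.

Definition compF g f : {ffun gT -> gT} := [ffun x => g (f x)].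

Definition Inj P Q : {set {ffun gT -> gT}} :=
  [set f : {ffun gT -> gT} |
    [&& morphic P f, dinjectiveb f P, f @: P \subset Q & f == restrF P f]].

(** MathComp's [x ^ g] is [g^-1 * x * g]; since [g] ranges over a group, the
    opposite convention gives the same set of maps. *)
Definition Hom_S S P Q : {set {ffun gT -> gT}} :=
  [set restrF P (conjg^~ g) | g in S & P :^ g \subset Q].

Definition Aut_S S P : {set {perm gT}} := conj_aut P @* 'N_S(P).

Canonical Aut_S_group S P := [group of Aut_S S P].

(** The image of [P], as a group; when [phi] is a homomorphism on [P] the
    generated-subgroup brackets have no effect, see [imgE]. *)
Definition img phi (P : {set gT}) : {group gT} := generated_group (phi @: P).

Lemma imgE P Q phi : phi \in Inj P Q -> img phi P = phi @: P :> {set gT}.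
Proof.
rewrite inE => /and4P[phiM _ _ _].
have E: phi @: P = morphm phiM @* P by rewrite morphimEdom.
by rewrite /img /= E genGid.
Qed.

(** The equation says that [phi c_g phi^-1 = a] on [img phi P]. *)
Definition Nphi S P phi : {set gT} :=
  [set g in 'N_S(P) | [exists a in Aut_S S (img phi P),
                        [forall x in P, phi (x ^ g) == a (phi x)]]].

Lemma Nphi_group_set S P phi : group_set (Nphi S P phi).
Proof.
apply/group_setP; split=> [|g h].
  rewrite inE group1; apply/existsP; exists 1; rewrite group1 /=.
  by apply/forall_inP=> x _; rewrite conjg1 perm1.
case/setIdP=> Ng /exists_inP[a Aa /forall_inP ga].
case/setIdP=> Nh /exists_inP[b Ab /forall_inP hb].
have /setIP[_ NgP] := Ng.
apply/setIdP; split; first exact: groupM.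
apply/exists_inP; exists (a * b); first exact: groupM.
apply/forall_inP=> x Px; rewrite permM conjgM (eqP (hb _ _)) ?memJ_norm //.
by rewrite (eqP (ga _ _)).
Qed.

Canonical Nphi_group S P phi := Group (Nphi_group_set S P phi).

End Maps.

Definition cat_iso (gT : finGroupType)
    (Hom : {group gT} -> {group gT} -> {set {ffun gT -> gT}})
    (P Q : {group gT}) (f : {ffun gT -> gT}) : Prop :=
  f \in Hom P Q /\
  exists g, [/\ g \in Hom Q P, compF g f = idF P & compF f g = idF Q].

(** [fus_Hom P Q] is only constrained, and only ever used, for subgroups [P]
    and [Q] of [S].  The identities come from [fus_Hom_S], with [g = 1]. *)
Record fusion_system (gT : finGroupType) (S : {group gT}) := FusionSystem {
  fus_Hom : {group gT} -> {group gT} -> {set {ffun gT -> gT}};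
  fus_Hom_S : forall P Q : {group gT}, P \subset S -> Q \subset S ->
    Hom_S S P Q \subset fus_Hom P Q;
  fus_Hom_Inj : forall P Q : {group gT}, P \subset S -> Q \subset S ->
    fus_Hom P Q \subset Inj P Q;
  fus_Hom_comp : forall (P Q R : {group gT}) (f g : {ffun gT -> gT}),
    P \subset S -> Q \subset S -> R \subset S ->
    f \in fus_Hom P Q -> g \in fus_Hom Q R -> compF g f \in fus_Hom P R;
  fus_Hom_factor : forall (P Q : {group gT}) (f : {ffun gT -> gT}),
    P \subset S -> Q \subset S -> f \in fus_Hom P Q ->
    exists (R : {group gT}) (f' : {ffun gT -> gT}),
      [/\ R \subset Q, cat_iso fus_Hom P R f' & f = compF (idF R) f']
}.

Section FusionSystems.

Variables (gT : finGroupType) (S : {group gT}) (F : fusion_system S).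
Implicit Types P Q : {group gT}.

Definition fus_conj P Q : Prop := exists f, cat_iso (fus_Hom F) P Q f.

Definition Aut_F P : {set {perm gT}} :=
  [set a in Aut P | restrF P a \in fus_Hom F P P].

Lemma Aut_F_group_set P : P \subset S -> group_set (Aut_F P).
Proof.
move=> sPS; apply/group_setP; split=> [|a b].
  rewrite inE group1 /=; apply: (subsetP (fus_Hom_S F sPS sPS)).
  apply/imsetP; exists 1; first by rewrite inE group1 conjsg1 subxx.
  by apply/ffunP=> x; rewrite !ffunE perm1 conjg1.
case/setIdP=> Aa Fa; case/setIdP=> Ab Fb; rewrite inE groupM //=.
suff ->: restrF P (a * b) = compF (restrF P b) (restrF P a).
  exact: fus_Hom_comp Fa Fb.
apply/ffunP=> x; rewrite !ffunE permM; case: (boolP (x \in P)) => Px.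
  by rewrite (Aut_closed Aa).
by rewrite group1 -(autmE Ab) morph1.
Qed.

Definition fully_centralized P : Prop :=
  forall Q, Q \subset S -> fus_conj P Q -> #|'C_S(Q)| <= #|'C_S(P)|.

Definition fully_normalized P : Prop :=
  forall Q, Q \subset S -> fus_conj P Q -> #|'N_S(Q)| <= #|'N_S(P)|.

Definition saturated (p : nat) : Prop :=
  (forall P, P \subset S -> fully_normalized P ->
     fully_centralized P /\ p.-Sylow(Aut_F P) (Aut_S S P)) /\
  (forall P phi, P \subset S -> phi \in fus_Hom F P S ->
     fully_centralized (img phi P) ->
     exists2 psi, psi \in fus_Hom F (Nphi_group S P phi) S
                & {in P, psi =1 phi}).

(** The condition N_F(S) = F. *)
Definition normalizer_is_all : Prop :=
  forall Q Q' phi, Q \subset S -> Q' \subset S -> phi \in fus_Hom F Q Q' ->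
  exists2 psi, psi \in Aut_F S & {in Q, phi =1 psi}.

End FusionSystems.

Definition resistant (p : nat) (gT : finGroupType) (S : {group gT}) : Prop :=
  forall F : fusion_system S, saturated F p -> normalizer_is_all F.

(* Main.v *)
Require Import Defs.
From mathcomp Require Import all_boot all_fingroup all_solvable.

(** Induct on |S : Q|: maps out of strictly larger subgroups extend to S.  As in
    Alperin's fusion theorem, transporting normalizers to a fully normalized
    conjugate reduces the claim to an automorphism b of a fully normalized R < S,
    which only has to be extended to some subgroup larger than R.

    Let N = N_S(R), G = Aut_F(R), P = Aut_S(R) (Sylow in G) and V = R / Phi(R).
    The kernel of G on V is a normal p-subgroup, hence lies in P.  If some g in
    N \ R centralizes V, then b c_g b^-1 lies in this kernel and b extends.
    Otherwise N / R is faithful on V, which has order p^2 since R is metacyclic,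
    and N / R is generated by a transvection u of V.  If u^b is a power of u, then
    b normalizes P and extends to N.  If not, u and u^b fix different lines and
    generate, as in SL_2(p), an element of G acting as -1 on V; it normalizes P,
    so it extends to N.  But N / Phi(R) is metacyclic, nonabelian, and larger than
    p^2, so it has an element y with y^p <> 1, and y^p = [e, y] for some e in V.
    As p is odd, g |-> g^p and g |-> [e, g] then agree on N / Phi(R), and an
    automorphism inverting V would force y^2p = 1. *)

Set Implicit Arguments.
Unset Strict Implicit.
Unset Printing Implicit Defensive.

Local Open Scope group_scope.

(** * Metacyclic quotients and elementary abelian groups of rank at most two *)

(** A metacyclic group is a product of two cyclic subgroups, and each of them has image of order at
    most p in a quotient of exponent p. *)
Lemma metacyclic_quotient_card p (gT : finGroupType) (G K : {group gT}) :
    0 < p -> metacyclic G -> G \subset 'N(K) ->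
  {in G / K, forall x, x ^+ p = 1} -> #|G / K| <= p ^ 2.
Proof.
move=> p_gt0 /metacyclicP[H [/cyclicP[a defH] /andP[sHG nHG] cycq]] nKG expG.
have [b Gb defG]: exists2 b, b \in G & G \subset H * <[b]>.
  have /cyclicP[X defX] := cycq.
  have: X \in G / H by rewrite defX cycle_id.
  case/morphimP=> b nHb Gb def_b; exists b => //.
  rewrite -quotientSK // quotient_cycle // defX def_b //.
have leo x : x \in G -> #|<[x]> / K| <= p.
  move=> Gx; have nKx := subsetP nKG x Gx.
  rewrite quotient_cycle // -orderE dvdn_leq // order_dvdn expG //.
  exact: mem_quotient.
have Ga: a \in G by rewrite -cycle_subG -defH.
have sGq: G / K \subset (<[a]> / K) * (<[b]> / K).
  rewrite -quotientMl ?cycle_subG ?(subsetP nKG) //.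
  by rewrite quotientS // -defH.
apply: leq_trans (subset_leq_card sGq) _.
rewrite expnS expn1 (leq_trans _ (leq_mul (leo a Ga) (leo b Gb))) //.
by rewrite mul_cardG leq_pmulr ?cardG_gt0.
Qed.

Section PrimeOrder.

Variables (gT : finGroupType) (p : nat) (p_pr : prime p).
Implicit Types (e f : gT) (V : {group gT}).

Lemma cycle_prime_eq e f : #[e] = p -> f \in <[e]> -> f != 1 -> <[f]> = <[e]>.
Proof.
move=> oe ef nf; symmetry; apply: nt_gen_prime; first by rewrite -orderE oe.
by rewrite !inE nf.
Qed.

Lemma abelem_p2_cycles V e f :
    p.-abelem V -> #|V| <= p ^ 2 -> e \in V -> e != 1 -> f \in V ->
  f \notin <[e]> -> V :=: <[e]> * <[f]>.
Proof.
move=> abV leV Ve ne Vf nf.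
have oe: #[e] = p := abelem_order_p abV Ve ne.
have nf1: f != 1 by apply: contraNneq nf => ->.
have of_: #[f] = p := abelem_order_p abV Vf nf1.
apply/esym/eqP; rewrite eqEcard mul_subG ?cycle_subG //=.
rewrite TI_cardMg -?orderE ?oe ?of_ //.
apply/trivgP/subsetP=> x /setIP[ex fx]; apply: contraR nf => nx.
rewrite -cycle_subG -(cycle_prime_eq of_ fx) ?cycle_subG //.
by rewrite inE in nx.
Qed.

End PrimeOrder.

(** * Automorphisms acting trivially modulo the Frattini subgroup *)

Section PhiStab.

Variables (gT : finGroupType) (p : nat) (R : {group gT}) (pR : p.-group R).

(** Burnside's argument: by Cauchy it suffices to exclude an [f] in [A] of prime order q <> p. Its
    fixed points generate R together with Phi(R), hence already generate R, so f = 1. *)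
Lemma pgroup_stab_Phi (A : {group {perm gT}}) :
    A \subset Aut R ->
    {in A & R, forall (a : {perm gT}) x, coset 'Phi(R) (a x) = coset 'Phi(R) x} ->
  p.-group A.
Proof.
move=> sAA stA; have [sPhi nPhi] := andP (Phi_normal R).
apply/pgroupP=> q q_pr /(Cauchy q_pr)[f Af of_].
rewrite inE /=; apply: contraT => neq_qp.
have AutRf := subsetP sAA f Af.
have stf x i : x \in R -> coset 'Phi(R) ((f ^+ i) x) = coset 'Phi(R) x.
  by move=> Rx; rewrite stA ?groupX.
have gC: group_set [set x in R | f x == x].
  apply/group_setP; split=> [|x y].
    by rewrite inE group1 -(autmE AutRf) morph1 /=.
  rewrite !inE => /andP[Rx /eqP fx] /andP[Ry /eqP fy].
  by rewrite groupM // -(autmE AutRf) morphM //= autmE fx fy.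
pose C := Group gC.
have sRC: R \subset C.
  rewrite -[gval C]genGid (@Phi_nongen _ R) //.
  apply/eqP; rewrite eqEsubset join_subG sPhi /=; apply/andP; split.
    by apply/subsetP=> x; rewrite inE => /andP[].
  apply/subsetP=> x Rx; have nx := subsetP nPhi x Rx.
  have qf: q.-group <[f]> by rewrite /pgroup -orderE of_ pnat_id.
  have sPxR y : y \in 'Phi(R) :* x -> y \in R.
    by case/rcosetP=> z Pz ->; rewrite groupM // (subsetP sPhi).
  have acts: [acts <[f]>, on 'Phi(R) :* x | perm_action gT].
    rewrite cycle_subG !inE; apply/subsetP=> y Py; rewrite inE /= /aperm.
    have Ry := sPxR y Py; have ny := subsetP nPhi _ Ry.
    have nfy := subsetP nPhi _ (Aut_closed AutRf Ry).
    by apply/rcoset_kercosetP; rewrite // stA //; apply/rcoset_kercosetP.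
  (* A coset of [Phi(R)] has p-power size, so [f], of prime order [q <> p], fixes
     a point in it; hence the fixed points generate [R] modulo [Phi(R)]. *)
  have := pgroup_fix_mod qf acts; rewrite card_rcoset.
  have [-> | [y]] := set_0Vmem 'Fix_('Phi(R) :* x | perm_action gT)(<[f]>).
    rewrite cards0 mod0n => /eqP q_dv.
    have := pgroupP (pgroupS sPhi pR) q q_pr q_dv.
    by rewrite inE /= (negPf neq_qp).
  case/setIP=> Py /afixP fixy _.
  have Cy: y \in C.
    by rewrite inE (sPxR y) //= -[f y]/(aperm y f) [aperm y f]fixy ?cycle_id.
  have : x \in 'Phi(R) :* y by rewrite rcoset_sym.
  case/rcosetP=> z Pz ->.
  by rewrite groupM // mem_gen //; apply/setUP; [left | right].
suff f1: f = 1 by rewrite -of_ f1 order1 in q_pr.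
apply: (eq_Aut AutRf (group1 _)) => x Rx.
by have := subsetP sRC x Rx; rewrite inE perm1 => /andP[_ /eqP].
Qed.

End PhiStab.

(** * Extensions of a self-centralizing plane *)

Section ExtensionOfPlane.

Variables (p : nat) (p_pr : prime p) (gT : finGroupType) (M V : {group gT}).
Hypotheses (pM : p.-group M) (nsVM : V <| M) (abV : p.-abelem V).
Hypotheses (leV : #|V| <= p ^ 2) (cVV : 'C_M(V) \subset V).

(** The subgroup [V, M] is nontrivial and, by nilpotency, proper in V, so it has order p and is
    central. Commutation with a suitable f in V then takes values in <z>, where z = [f, y]; this
    makes M / V cyclic, and y^p lies in <z> because it is an element of V commuting with y. *)
Lemma plane_ext_gens y :
    y \in M -> y ^+ p != 1 ->
  exists2 e, e \in V &
    [/\ [~ e, y] = y ^+ p, y ^+ p \in 'Z(M), [~: V, M] \subset 'Z(M)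
      & M :=: V * <[y]>].
Proof.
move=> My ny; have [sVM nVM] := andP nsVM.
have cVabV : abelian V := abelem_abelian abV.
have expV : forall x, x \in V -> x ^+ p = 1 by case/(abelemP p_pr): abV.
have Vy : y \notin V by apply: contraNN ny => /expV->.
have ntV : V :!=: 1.
  apply: contraNneq Vy => V1.
  by rewrite (subsetP cVV) // V1 inE My cent1T inE.
pose L := [~: V, M].
have sLV : L \subset V by rewrite commg_subl.
have prL : L \proper V.
  by apply: (nil_comm_properl (pgroup_nil pM)); rewrite // subsetI subxx.
have pV := abelem_pgroup abV.
have pL : p.-group L := pgroupS sLV pV.
have ntL : L != 1.
  apply: contraNneq Vy => /commG1P cVM.
  by rewrite (subsetP cVV) // inE My (subsetP _ _ My) // centsC.
have nsLM : L <| M.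
  by rewrite /normal (subset_trans sLV) //= normsR // normG.
have oL : #|L| = p.
  have [_ _ [k oL]] := pgroup_pdiv pL ntL.
  apply/eqP; rewrite oL -[X in _ == X]expn1 eqn_exp2l ?prime_gt1 //.
  rewrite eqSS -leqn0 -ltnS -ltnS -(ltn_exp2l _ _ (prime_gt1 p_pr)) -oL.
  exact: leq_trans (proper_card prL) leV.
have sLZ : L \subset 'Z(M).
  have [] := @prime_subgroupVti _ [group of L] 'Z(M); rewrite /= ?oL //.
  move=> tiZL; case/negP: (meet_center_nil (pgroup_nil pM) nsLM ntL).
  by rewrite setIC tiZL.
have [f Vf nfy] : exists2 f, f \in V & [~ f, y] != 1.
  apply/exists_inP; apply: contraR Vy => /exists_inPn cVy.
  rewrite (subsetP cVV) // inE My; apply/centP=> f Vf.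
  by apply/commgP; have /negPn := cVy f Vf; rewrite -invg_comm eq_invg1.
set z := [~ f, y] in nfy.
have Lz : z \in L by rewrite mem_commg.
have Vz : z \in V := subsetP sLV z Lz.
have Zz : z \in 'Z(M) := subsetP sLZ z Lz.
have cz x : x \in M -> commute x z by move=> Mx; apply: centerC Mx _ Zz.
have defL : L = <[z]>.
  by apply: nt_gen_prime; rewrite ?oL // !inE nfy.
have Lf : f \notin L.
  by apply: contraNN nfy => /(subsetP sLZ)/setIP[_ /centP/(_ y My)/commgP].
have defV : V :=: <[z]> * <[f]>.
  by apply: (abelem_p2_cycles p_pr abV); rewrite // -defL.
have Mf := subsetP sVM f Vf.
have defM : M :=: V * <[y]>.
  apply/eqP; rewrite eqEsubset mul_subG ?cycle_subG // andbT.
  (* Some power y^k satisfies [f, y^k] = [f, g]; then g y^-k centralizes both z and f, hence V, and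
     so lies in V. *)
  apply/subsetP=> g Mg; have : [~ f, g] \in L by rewrite mem_commg.
  rewrite defL => /cycleP[k fg].
  have fyk : [~ f, y ^+ k] = z ^+ k.
    by rewrite commgX // -/z; apply: cz.
  rewrite -[g](mulgKV (y ^+ k)) mem_mulg ?mem_cycle // (subsetP cVV) //.
  rewrite inE groupM ?groupV ?groupX //=.
  rewrite defV centM inE !cent_cycle; apply/andP; split; apply/cent1P.
    by apply: cz; rewrite groupM ?groupV ?groupX.
  apply/commute_sym/commgP; rewrite commgMJ fg commgV fyk; last first.
    by apply: commuteX; apply: cz; rewrite groupX.
  have /commgP/conjg_fixP-> : commute (z ^+ k) (y ^- k).
    by apply/commuteV/commute_sym/commuteX/cz; rewrite groupX.
  by rewrite mulVg.
have Vyp : y ^+ p \in V.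
  rewrite (subsetP cVV) // inE groupX //= defV centM inE !cent_cycle.
  apply/andP; split; apply/cent1P.
    by apply: cz; rewrite groupX.
  by apply/commute_sym/commgP; rewrite commgX -/z ?expV //; apply: cz.
have Zyp : y ^+ p \in 'Z(M).
  rewrite inE groupX //= defM centM inE cent_cycle.
  rewrite (subsetP cVabV) //=; apply/cent1P; exact: commute_sym (commuteX _ (commute_refl _)).
(* Write y^p = z^i f^j. As y commutes with y^p and z, it commutes with f^j, so z^j = [f^j, y] = 1
   and p divides j. *)
have [k def_k] : exists k, y ^+ p = z ^+ k.
  have : y ^+ p \in V by [].
  rewrite {1}defV => /mulsgP[w1 w2 /cycleP[i ->] /cycleP[j ->] def_yp].
  have fj1: f ^+ j = 1.
    apply/eqP; have: [~ f ^+ j, y] == 1.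
      have cyz : commute y (z ^+ i) by apply/commuteX/cz.
      apply/commgP; rewrite -(mulKg (z ^+ i) (f ^+ j)) -def_yp.
      apply/commute_sym/commuteM; last exact: commuteX.
      exact: commuteV.
    rewrite commXg -/z; last exact: cz.
    rewrite -order_dvdn (abelem_order_p abV Vz nfy) -order_dvdn.
    by apply: dvdn_trans; rewrite order_dvdn expV.
  by exists i; rewrite def_yp fj1 mulg1.
(* [y ^+ p] need not be [z]: rescale [f]. *)
exists (f ^+ k); first exact: groupX.
by rewrite commXg -/z -?def_k //; apply: cz.
Qed.

(** Both sides are homomorphisms in [g], trivial on [V] and equal at [y]. *)
Lemma plane_ext_comm y e :
    odd p -> e \in V -> [~ e, y] = y ^+ p -> [~: V, M] \subset 'Z(M) ->
  M :=: V * <[y]> -> {in M, forall g, [~ e, g] = g ^+ p}.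
Proof.
move=> p_odd Ve def_yp sLZ defM g.
have [sVM nVM] := andP nsVM.
have expV : forall x, x \in V -> x ^+ p = 1 by case/(abelemP p_pr): abV.
have My : y \in M by rewrite defM -{1}[y]mul1g mem_mulg ?cycle_id ?group1.
rewrite {1}defM => /mulsgP[v w Vv /cycleP[k ->] ->].
have comm_cz v' x g' : v' \in V -> x \in M -> g' \in M -> commute g' [~ v', x].
  by move=> Vv' Mx Mg; apply: centerC (subsetP sLZ _ _) => //; rewrite mem_commg.
have Mv := subsetP sVM v Vv; have Myk := groupX k My.
have -> : [~ e, v * y ^+ k] = (y ^+ p) ^+ k.
  have /commgP/eqP cev : commute e v.
    by apply: (centsP (abelem_abelian abV)).
  by rewrite commgMJ cev conj1g mulg1 commgX -?def_yp //; apply: comm_cz.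
have comm_cz' g' : g' \in M -> commute g' [~ y ^+ k, v].
  by move=> Mg; rewrite -invg_comm; apply/commuteV/comm_cz.
rewrite expMg_Rmul ?(expV v) ?mul1g //; try exact: comm_cz'.
(* In class two, (v y^k)^p carries the factor [y^k, v]^C(p,2). Oddness of p makes p divide the
   binomial coefficient, and V has exponent p. *)
have /dvdnP[m ->] : p %| 'C(p, 2).
  by rewrite prime_dvd_bin //= odd_prime_gt2.
have -> : [~ y ^+ k, v] ^+ (m * p) = 1.
  rewrite mulnC expgM expV ?expg1n // commgEr groupM // memJ_norm ?groupV //.
  exact: (subsetP nVM).
by rewrite mulg1 -!expgM mulnC.
Qed.

End ExtensionOfPlane.

(** * Transvections of a plane *)

Section AutPlane.

Variables (gT : finGroupType) (V : {group gT}).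
Implicit Types (s : {perm gT}) (x y z : gT).

Lemma Aut_permM s x y : s \in Aut V -> x \in V -> y \in V -> s (x * y) = s x * s y.
Proof. by move=> As; move/morphicP: (Aut_morphic As); apply. Qed.

Lemma Aut_permX s x n : s \in Aut V -> x \in V -> s (x ^+ n) = s x ^+ n.
Proof. by move=> As Vx; rewrite -(autmE As) morphX. Qed.

Lemma Aut_permV s x : s \in Aut V -> x \in V -> s x^-1 = (s x)^-1.
Proof. by move=> As Vx; rewrite -(autmE As) morphV. Qed.

Lemma perm_shearX s x z n : s \in Aut V -> x \in V -> z \in V ->
  s z = z -> s x = x * z -> (s ^+ n) x = x * z ^+ n.
Proof.
move=> As Vx Vz sz sx; elim: n => [|n IHn]; first by rewrite perm1 mulg1.
by rewrite expgSr permM IHn Aut_permM ?groupX // sx Aut_permX // sz -mulgA -expgS.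
Qed.

Variables (p : nat) (p_pr : prime p) (abV : p.-abelem V) (leV : #|V| <= p ^ 2).
Variables (A : {group {perm gT}}) (sAV : A \subset Aut V).

(** Here u is a transvection fixing the line <e1>, and u^a is one fixing <a e1>. If the lines agree,
    both lie in the same group of order p. Otherwise they are unitriangular of opposite types in a
    suitable basis, and generate -1. *)
Lemma plane_shear_dichotomy u a e1 e2 :
    u \in A -> a \in A -> e1 \in V -> e2 \in V -> e1 != 1 -> e2 \notin <[e1]> ->
    u e1 = e1 -> u e2 = e2 * e1 ->
  (exists k, u ^ a = u ^+ k) \/ (exists2 b, b \in A & {in V, forall v, b v = v^-1}).
Proof.
move=> Au Aa Ve1 Ve2 nt_e1 e2'1 ue1 ue2.
have cV x y : x \in V -> y \in V -> commute x y.
  by move=> Vx; apply: (centsP (abelem_abelian abV)).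
have VA s : s \in A -> s \in Aut V by apply: subsetP.
have closA s x : s \in A -> x \in V -> s x \in V by move=> /VA As; apply: Aut_closed.
have Aua : u ^ a \in A by rewrite groupJ.
have oe1 : #[e1] = p := abelem_order_p abV Ve1 nt_e1.
have nt_e2 : e2 != 1 by apply: contraNneq e2'1 => ->.
have oe2 : #[e2] = p := abelem_order_p abV Ve2 nt_e2.
have uP w : w \in V -> exists i j, w = e1 ^+ i * e2 ^+ j /\ u w = w * e1 ^+ j.
  rewrite (abelem_p2_cycles p_pr abV leV Ve1 nt_e1 Ve2 e2'1).
  case/mulsgP=> _ _ /cycleP[i ->] /cycleP[j ->] ->; exists i, j; split=> //.
  rewrite Aut_permM ?Aut_permX ?groupX ?VA // ue1 ue2 expgMn; last exact: cV.
  by rewrite mulgA.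
have uaP w : w \in V -> exists i j, w = a (e1 ^+ i * e2 ^+ j) /\ (u ^ a) w = w * a e1 ^+ j.
  move=> Vw; have Vw' : a^-1 w \in V by rewrite closA ?groupV.
  have [i [j [def_w' uw']]] := uP _ Vw'; exists i, j.
  rewrite -def_w' permKV; split=> //.
  by rewrite -{1}(permKV a w) permJ uw' Aut_permM ?Aut_permX ?VA ?groupX // permKV.
set f2 := a e1; have Vf2 : f2 \in V by apply: closA.
have nt_f2 : f2 != 1.
  by apply: contraNneq nt_e1 => f2_1; apply/eqP/(@perm_inj _ a); rewrite -(autmE (VA _ Aa)) morph1.
have of2 : #[f2] = p := abelem_order_p abV Vf2 nt_f2.
have uaf2 : (u ^ a) f2 = f2 by rewrite permJ ue1.
have [f2e1 | f2'1] := boolP (f2 \in <[e1]>); [left | right].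
  have def_e1 := cycle_prime_eq p_pr oe1 f2e1 nt_f2.
  have uae1 : (u ^ a) e1 = e1.
    have: e1 \in <[f2]> by rewrite def_e1 cycle_id.
    by case/cycleP=> i ->; rewrite Aut_permX ?VA // uaf2.
  have [i [j [_ uae2]]] := uaP _ Ve2.
  (* Both maps fix e1, and u^a moves e2 by f2^j = e1^m, so u^a = u^m. *)
  have: f2 ^+ j \in <[e1]> by rewrite groupX.
  rewrite -/f2 in uae2; case/cycleP=> m def_f2j; exists m.
  apply: (eq_Aut (VA _ Aua)) => [|w Vw]; first by rewrite VA ?groupX.
  have [k [l [-> _]]] := uP _ Vw.
  rewrite !Aut_permM ?Aut_permX ?groupX ?VA ?groupX // uae1 uae2 def_f2j.
  rewrite (perm_shearX _ _ _ _ ue1 ue2) ?VA //; congr (_ ^+ _ * _).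
  by elim: (m) => [|n IHn]; rewrite ?perm1 // expgSr permM -IHn.
(* The basis is normalized so that u f2 = f2 f1; the exponent m below then makes t = (u^a)^m send f1
   to f1 f2^-1. *)
have [i [j [def_f2 uf2]]] := uP _ Vf2.
set f1 := e1 ^+ j in uf2; have Vf1 : f1 \in V by rewrite groupX.
have nt_f1 : f1 != 1.
  apply: contraNneq f2'1 => /eqP; rewrite -order_dvdn oe1 -oe2 order_dvdn => /eqP e2j.
  by rewrite def_f2 e2j mulg1 mem_cycle.
have def_e1 := cycle_prime_eq p_pr oe1 (mem_cycle e1 j : f1 \in _) nt_f1.
have f2'f1 : f2 \notin <[f1]> by rewrite def_e1.
have uf1 : u f1 = f1 by rewrite Aut_permX ?VA // ue1.
have [k [l [def_f1 uaf1]]] := uaP _ Vf1; rewrite -/f2 in uaf1.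
have nt_f2l : f2 ^+ l != 1.
  apply: contraNneq f2'f1 => /eqP; rewrite -order_dvdn of2 -oe2 order_dvdn => /eqP e2l.
  rewrite e2l mulg1 Aut_permX ?VA // -/f2 in def_f1.
  have f1f2 : f1 \in <[f2]> by rewrite def_f1 mem_cycle.
  by rewrite (cycle_prime_eq p_pr of2 f1f2 nt_f1) cycle_id.
have [m def_f2V] : exists m, f2^-1 = f2 ^+ l ^+ m.
  apply/cycleP; rewrite (cycle_prime_eq p_pr of2 (mem_cycle _ _) nt_f2l).
  by rewrite groupV cycle_id.
pose t := (u ^ a) ^+ m.
have At : t \in A by rewrite groupX.
have tf1 : t f1 = f1 * f2^-1.
  rewrite (perm_shearX m _ _ _ _ uaf1) ?VA ?groupX -?def_f2V //.
  by rewrite Aut_permX ?VA // uaf2.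
have tf2 : t f2 = f2.
  by rewrite /t; elim: (m) => [|n IHn]; rewrite ?perm1 // expgSr permM IHn.
(* [w] is the matrix (0 1; -1 0) in the basis [f1], [f2], so its square is -1. *)
pose w := u * t * u; have Aw : w \in A by rewrite !groupM.
have wf1 : w f1 = f2^-1.
  rewrite !permM uf1 tf1 Aut_permM ?Aut_permV ?groupV ?VA // uf1 uf2 invMg.
  by rewrite mulKVg.
have wf2 : w f2 = f1.
  rewrite !permM uf2 Aut_permM ?VA // tf1 tf2 (cV f1) ?groupV // mulKVg.
  exact: uf1.
exists (w * w); first by rewrite groupM.
move=> v; rewrite {1}(abelem_p2_cycles p_pr abV leV Vf1 nt_f1 Vf2 f2'f1).
case/mulsgP=> _ _ /cycleP[r ->] /cycleP[s ->] ->.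
have wV x y i0 j0 : x \in V -> y \in V ->
    w (x ^+ i0 * y ^+ j0) = w x ^+ i0 * w y ^+ j0.
  by move=> Vx Vy; rewrite Aut_permM ?Aut_permX ?groupX ?VA.
rewrite permM !wV ?closA // wf1 wf2 Aut_permV ?VA // wf1 wf2 invMg -(expgVn f1) -(expgVn f2).
by apply: cV; rewrite groupX ?groupV.
Qed.

End AutPlane.

(** * Automorphisms induced on a characteristic quotient *)

Section QuotientAut.

Variables (gT : finGroupType) (R H : {group gT}) (chH : H \char R).

Lemma Aut_sub_qact_dom : Aut R \subset qact_dom [Aut R] H.
Proof.
by rewrite qact_domE ?(char_sub chH) //; apply: acts_char.
Qed.

(** Going through the quotient of the automorphism action yields multiplicativity and membership in
    [Aut (R / H)] from the general theory of actions. *)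
Definition quo_aut : {perm gT} -> {perm coset_of H} := actperm ([Aut R] / H).

Lemma quo_autE a x : a \in Aut R -> x \in R -> quo_aut a (coset H x) = coset H (a x).
Proof.
move=> Aa Rx; have nHx := subsetP (char_norm chH) x Rx.
by rewrite /quo_aut actpermE qactE // (subsetP Aut_sub_qact_dom).
Qed.

Lemma quo_aut_Aut a : a \in Aut R -> quo_aut a \in Aut (R / H).
Proof.
move=> Aa; apply: (subsetP (im_actperm_Aut ([Aut R] / H))).
by rewrite mem_morphim ?(subsetP Aut_sub_qact_dom).
Qed.

Lemma quo_autM : {in Aut R &, {morph quo_aut : a b / a * b}}.
Proof.
by move=> a b Aa Ab; rewrite /quo_aut actpermM ?(subsetP Aut_sub_qact_dom).
Qed.

Canonical quo_aut_morphism := Morphism quo_autM.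

End QuotientAut.

(** * The Sylow subgroup induced by a metacyclic normalizer *)

Section MetacyclicExtension.

Variables (p : nat) (gT : finGroupType) (R N : {group gT}).
Variable (G : {group {perm gT}}).
Hypotheses (p_pr : prime p) (p_odd : odd p) (pN : p.-group N).
Hypotheses (mcN : metacyclic N) (nsRN : R <| N) (sGA : G \subset Aut R).

Let P := conj_aut R @* N.
Hypothesis sylP : p.-Sylow(G) P.

Let sRN : R \subset N := normal_sub nsRN.
Let nRN : N \subset 'N(R) := normal_norm nsRN.
Let pR : p.-group R := pgroupS sRN pN.
Let chPhi : 'Phi(R) \char R := Phi_char R.
Let sPhiR : 'Phi(R) \subset R := Phi_sub R.
Let nPhiN : N \subset 'N('Phi(R)) := char_norm_trans chPhi nRN.
Let nPhiR : R \subset 'N('Phi(R)) := char_norm chPhi.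

Local Notation rho := (quo_aut R 'Phi(R)).

(** The kernel of G on R / Phi(R) is a normal p-subgroup, so it lies in the Sylow subgroup P. *)
Lemma stab_Phi_sub_Sylow a :
  a \in G -> {in R, forall x, coset 'Phi(R) (a x) = coset 'Phi(R) x} -> a \in P.
Proof.
move=> Ga sta; pose K := 'ker_G (quo_aut_morphism chPhi).
have AG b : b \in G -> b \in Aut R by apply: subsetP.
have kerGP b : b \in G ->
    reflect {in R, forall x, coset 'Phi(R) (b x) = coset 'Phi(R) x} (rho b == 1).
  move=> Gb; apply: (iffP eqP) => [rb1 x Rx | stb].
    by rewrite -(quo_autE chPhi) ?AG // rb1 perm1.
  apply: (eq_Aut (quo_aut_Aut chPhi (AG b Gb)) (group1 _)) => X.
  by case/morphimP=> x _ Rx ->; rewrite perm1 (quo_autE chPhi) ?AG ?stb //.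
have KE b : (b \in K) = (b \in G) && (rho b == 1).
  rewrite inE; apply: andb_id2l => Gb.
  exact: (sameP (kerP (quo_aut_morphism chPhi) (AG b Gb)) eqP).
have pK : p.-group K.
  apply: (pgroup_stab_Phi pR) => [|b x].
    by apply: subset_trans sGA; apply: subsetIl.
  by rewrite KE => /andP[Gb /(kerGP b Gb)]; apply.
have nsKG : K <| G.
  by rewrite /normal subsetIl normsI ?normG //= (subset_trans sGA) ?ker_norm.
have sKP : K \subset P := normal_sub_max_pgroup (Hall_max sylP) pK nsKG.
by rewrite (subsetP sKP) // KE Ga; apply/kerGP.
Qed.

Lemma quo_conj_aut g X :
  g \in N -> X \in R / 'Phi(R) -> rho (conj_aut R g) X = X ^ coset 'Phi(R) g.
Proof.
move=> Ng; case/morphimP=> x nx Rx ->.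
rewrite (quo_autE chPhi) ?Aut_aut // norm_conj_autE ?(subsetP nRN) //.
by rewrite -morphJ // (subsetP nPhiN).
Qed.

Hypothesis faithfulN :
  {in N, forall g, {in R, forall x, coset 'Phi(R) (x ^ g) = coset 'Phi(R) x} -> g \in R}.
Hypothesis properRN : ~~ (N \subset R).

Hypothesis extN : forall b, b \in 'N_G(P) ->
  exists2 theta : {morphism N >-> gT}, theta @* N \subset N & {in R, theta =1 b}.

(** Each a in G either sends the transvection u induced by y to a power of u, and then normalizes P,
    or produces an automorphism inverting V, which is contradictory. The hypothesis [extN] isolates
    what the extension axiom of a saturated fusion system provides. *)
Lemma metacyclic_Sylow_normal : G \subset 'N(P).
Proof.
have AG b : b \in G -> b \in Aut R by apply: subsetP.
pose M := (N / 'Phi(R))%G; pose V := (R / 'Phi(R))%G.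
have pM : p.-group M := quotient_pgroup _ pN.
have nsVM : V <| M := quotient_normal _ nsRN.
have abV : p.-abelem V := Phi_quotient_abelem pR.
have expV : forall X, X \in V -> X ^+ p = 1 by case/(abelemP p_pr): abV.
have leV : #|V| <= p ^ 2.
  apply: (metacyclic_quotient_card (prime_gt0 p_pr)) => //.
  exact: metacyclicS mcN.
have cVV : 'C_M(V) \subset V.
  apply/subsetP=> _ /setIP[/morphimP[g ng Ng ->] /centP cVg].
  apply: mem_quotient; apply: faithfulN => // x Rx.
  have nx := subsetP nPhiR x Rx.
  rewrite morphJ //; apply/conjg_fixP/commgP/commute_sym/cVg.
  exact: mem_quotient.
(* If M had exponent p, its order would be at most p^2; M would be abelian, hence contained in
   C_M(V) and so in V, against N not lying in R. *)
have [Y MY ntY] : exists2 Y, Y \in M & Y ^+ p != 1.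
  apply/exists_inP; apply: contraR properRN => /exists_inPn expM.
  rewrite -(quotientSGK nPhiN sPhiR); apply: subset_trans cVV.
  rewrite subsetI subxx (subset_trans _ (centS (quotientS _ sRN))) //.
  rewrite -/(abelian M) (p2group_abelian pM) //.
  rewrite -(leq_exp2l _ _ (prime_gt1 p_pr)) -p_part part_pnat_id //.
  apply: (metacyclic_quotient_card (prime_gt0 p_pr)) => // X MX.
  by apply/eqP; have := expM X MX; rewrite negbK.
have [sVM nVM] := andP nsVM.
have [E VE [comEY ZY sLZ defM]] := plane_ext_gens p_pr pM nsVM abV leV cVV MY ntY.
have comE := plane_ext_comm p_pr nsVM abV p_odd VE comEY sLZ defM.
have VYp : Y ^+ p \in V.
  by rewrite -comEY commgEl groupM ?groupV // memJ_norm // (subsetP nVM).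
have [y ny Ny defY] := morphimP MY; have [f nf Rf defE] := morphimP VE.
pose A := (quo_aut_morphism chPhi @* G)%G.
have sAV : A \subset Aut V.
  by apply/subsetP=> _ /morphimP[b Ab Gb ->]; apply: quo_aut_Aut.
have GP g : g \in N -> conj_aut R g \in G.
  by move=> Ng; rewrite (subsetP (pHall_sub sylP)) // mem_morphim // (subsetP nRN).
have AP b : b \in G -> rho b \in A.
  by move=> Gb; apply: (mem_morphim (quo_aut_morphism chPhi)); rewrite ?AG.
have VA B : B \in A -> B \in Aut V by apply: subsetP.
pose u := rho (conj_aut R y).
have Au : u \in A by rewrite AP ?GP.
have uE X : X \in V -> u X = X ^ Y by move=> VX; rewrite /u quo_conj_aut // defY.
have uY : u (Y ^+ p) = Y ^+ p by rewrite uE // conjXg conjgE mulKg.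
have uEE : u E = E * Y ^+ p by rewrite uE // -comEY commgEl mulKVg.
have E'Y : E \notin <[Y ^+ p]>.
  apply: contraNN ntY => /cycleP[i defEi]; rewrite -comEY; apply/commgP.
  by rewrite defEi -expgM; apply/commute_sym/commuteX/commute_refl.
(* Since P contains the kernel of G on V, membership in P, and hence normalizing P, can be tested on
   the images under [rho]. *)
have conjP b c : b \in G -> c \in P -> rho b = rho c -> b \in P.
  move=> Gb Pc eq_bc; have Gc := subsetP (pHall_sub sylP) c Pc.
  rewrite -(mulgKV c b) groupM // stab_Phi_sub_Sylow ?groupM ?groupV // => x Rx.
  rewrite -(quo_autE chPhi) ?groupM ?groupV ?AG //.
  by rewrite quo_autM ?groupV ?AG // eq_bc -quo_autM ?groupV ?AG // mulgV
             [rho 1](morph1 (quo_aut_morphism chPhi)) perm1.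
have normP b : b \in G ->
    (forall g, g \in N -> exists2 h, h \in N &
       rho (conj_aut R g) ^ rho b = rho (conj_aut R h)) -> b \in 'N(P).
  move=> Gb stb; rewrite inE; apply/subsetP=> _ /imsetP[_ /morphimP[g ng Ng ->] ->].
  have [h Nh eq_h] := stb g Ng.
  apply: (conjP _ (conj_aut R h)); rewrite ?groupJ ?GP //.
    by rewrite mem_morphim // (subsetP nRN).
  rewrite -eq_h; apply: (morphJ (quo_aut_morphism chPhi)); rewrite ?AG ?GP //.
apply/subsetP=> a Ga.
have := plane_shear_dichotomy p_pr abV leV sAV Au (AP a Ga) VYp VE ntY E'Y uY uEE.
case=> [[k uak] | [B AB invB]].
  (* The abelian group V acts trivially on itself, so g acts on V as a power y^j, and conjugation by
     a turns u^j into u^(kj). *)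
  apply: normP => // g Ng.
  have /mulsgP[v w Vv /cycleP[j ->] defg] : coset 'Phi(R) g \in V * <[Y]>.
    by rewrite -defM mem_quotient.
  exists (y ^+ (k * j)); first by rewrite groupX.
  have Nyj i : y ^+ i \in N by rewrite groupX.
  have rc i : rho (conj_aut R (y ^+ i)) = u ^+ i.
    by rewrite morphX ?(subsetP nRN) // (morphX (quo_aut_morphism chPhi)) ?AG ?GP.
  rewrite rc expgM -uak -conjXg -rc; congr (_ ^ _).
  apply: (eq_Aut (VA _ (AP _ (GP g Ng))) (VA _ (AP _ (GP _ (Nyj j))))) => X VX.
  rewrite !quo_conj_aut // defg conjgM; congr (_ ^ _).
    by apply/conjg_fixP/commgP/(centsP (abelem_abelian abV)).
  by rewrite morphX // -defY.
have [b Ab Gb defB] := morphimP AB; have {}defB : B = rho b := defB.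
rewrite {B}defB in AB invB.
(* Inversion commutes with every automorphism of V. *)
have nPb : b \in 'N(P).
  apply: normP => // g Ng; exists g => //.
  have Aug := VA _ (AP _ (GP g Ng)).
  apply: (eq_Aut _ Aug) => [|X VX]; first by rewrite groupJ // VA ?AP.
  have VXi : X^-1 \in V by rewrite groupV.
  rewrite -[X]invgK -(invB _ VXi) permJ !invB ?Aut_closed //.
  exact/esym/(Aut_permV Aug).
have [|theta sthN thb] := extN (b := b); first by rewrite inE Gb.
pose Z := coset 'Phi(R) (theta y).
have Nth g : g \in N -> theta g \in N by move=> Ng; rewrite (subsetP sthN) ?mem_morphim.
have nth g : g \in N -> theta g \in 'N('Phi(R)).
  by move=> Ng; rewrite (subsetP nPhiN) ?Nth.
have MZ : Z \in M by rewrite mem_quotient ?Nth.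
have thR x : x \in R -> coset 'Phi(R) (theta x) = (coset 'Phi(R) x)^-1.
  by move=> Rx; rewrite thb // -(quo_autE chPhi) ?AG // invB // mem_quotient.
have Nf := subsetP sRN f Rf.
have Ryp : y ^+ p \in R.
  rewrite -(quotientGK (normalS sPhiR sRN (char_normal_trans chPhi nsRN))).
  by rewrite mem_morphpre ?groupX //= morphX // -defY.
(* The extension theta inverts R modulo Phi(R), and y^p lies in R. *)
have ZpV : Z ^+ p = Y ^- p.
  by rewrite -morphX ?nth // -morphX //= thR // morphX // -defY.
(* Applying theta to [E, Y] = Y^p gives [E^-1, Z] = Y^-p, so [E, Z] = Y^p; but also [E, Z] = Z^p by
   [comE]. *)
have Zp : Z ^+ p = Y ^+ p.
  have: coset 'Phi(R) (theta [~ f, y]) = (coset 'Phi(R) [~ f, y])^-1.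
    by rewrite thR // commgEl groupM ?groupV // memJ_norm // (subsetP nRN).
  rewrite !morphR ?nth //= -defE -defY comEY thR // -defE.
  rewrite commVg ?comE // => [/invg_inj // |].
  apply: (centsP (abelem_abelian abV)) => //.
  by rewrite -comE // commgEl groupM ?groupV // memJ_norm // (subsetP nVM).
case/eqP: ntY; apply/eqP; rewrite -order_eq1 -dvdn1.
have <- : gcdn 2 p = 1%N by apply/eqP; rewrite -/(coprime 2 p) coprime2n.
rewrite dvdn_gcd !order_dvdn (expV _ VYp) eqxx andbT.
by rewrite expgS expg1 -{1}Zp ZpV mulVg.
Qed.

End MetacyclicExtension.

(** * Calculus of morphisms in a fusion system *)

Section InjMaps.

Variable gT : finGroupType.
Implicit Types (P Q : {group gT}) (f : {ffun gT -> gT}).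

Lemma InjP P Q f :
  reflect [/\ morphic P f, {in P &, injective f}, {in P, forall x, f x \in Q}
            & forall x, x \notin P -> f x = 1]
          (f \in Inj P Q).
Proof.
rewrite inE; apply: (iffP and4P) => [] [fM finj fPQ f1].
  split=> // [|x Px|x P'x]; first exact/dinjectiveP.
    by rewrite (subsetP fPQ) ?imset_f.
  by rewrite (eqP f1) ffunE (negPf P'x).
split=> //; first exact/dinjectiveP.
  by apply/subsetP=> _ /imsetP[x Px ->]; apply: fPQ.
apply/eqP/ffunP=> x; rewrite ffunE; case: ifPn => // P'x; exact: f1.
Qed.

End InjMaps.

Section FusionMaps.

Variables (gT : finGroupType) (S : {group gT}) (F : fusion_system S).
Implicit Types (P Q R : {group gT}) (f g phi psi : {ffun gT -> gT}).
Implicit Types a b : {perm gT}.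

Lemma fusP P Q phi : P \subset S -> Q \subset S -> phi \in fus_Hom F P Q ->
  [/\ morphic P phi, {in P &, injective phi}, {in P, forall x, phi x \in Q}
    & forall x, x \notin P -> phi x = 1].
Proof.
by move=> sPS sQS Fphi; apply/InjP; apply: (subsetP (fus_Hom_Inj F sPS sQS)).
Qed.

Lemma fus_conj_map P Q (g : gT) : P \subset S -> Q \subset S -> g \in S -> P :^ g \subset Q ->
  restrF P (conjg^~ g) \in fus_Hom F P Q.
Proof.
move=> sPS sQS Sg sPgQ; apply: (subsetP (fus_Hom_S F sPS sQS)).
by apply: imset_f; rewrite inE Sg.
Qed.

Lemma fus_incl P Q : P \subset Q -> Q \subset S -> idF P \in fus_Hom F P Q.
Proof.
move=> sPQ sQS; have sPS := subset_trans sPQ sQS.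
have -> : idF P = restrF P (conjg^~ 1) by apply/ffunP=> x; rewrite !ffunE conjg1.
by apply: fus_conj_map; rewrite ?group1 ?conjsg1.
Qed.

Lemma fus_restr P P' Q phi : P' \subset P -> P \subset S -> Q \subset S ->
  phi \in fus_Hom F P Q -> restrF P' phi \in fus_Hom F P' Q.
Proof.
move=> sP'P sPS sQS Fphi; have [phiM _ _ phi1] := fusP sPS sQS Fphi.
have -> : restrF P' phi = compF phi (idF P').
  apply/ffunP=> x; rewrite !ffunE; case: ifP => // _.
  exact/esym/(morph1 (morphm_morphism phiM)).
apply: fus_Hom_comp (fus_incl sP'P sPS) Fphi => //; exact: subset_trans sPS.
Qed.

Lemma fus_widen P Q Q' phi : P \subset S -> Q \subset Q' -> Q' \subset S ->
  phi \in fus_Hom F P Q -> phi \in fus_Hom F P Q'.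
Proof.
move=> sPS sQQ' sQ'S Fphi; have sQS := subset_trans sQQ' sQ'S.
have [_ _ phiQ phi1] := fusP sPS sQS Fphi.
have -> : phi = compF (idF Q) phi.
  apply/ffunP=> x; rewrite !ffunE.
  by have [/phiQ-> // | /phi1->] := boolP (x \in P); rewrite if_same.
by apply: fus_Hom_comp Fphi (fus_incl sQQ' sQ'S).
Qed.

(** The intermediate subgroup given by the factorization axiom can only be the image of [phi]. *)
Lemma fus_iso_img P Q phi : P \subset S -> Q \subset S -> phi \in fus_Hom F P Q ->
  cat_iso (fus_Hom F) P (img phi P) phi.
Proof.
move=> sPS sQS Fphi; have Iphi := subsetP (fus_Hom_Inj F sPS sQS) _ Fphi.
have [R [f [sRQ isof def_phi]]] := fus_Hom_factor sPS sQS Fphi.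
have sRS := subset_trans sRQ sQS.
have [Ff [g [Fg gf fg]]] := isof.
have [_ _ fR f1] := fusP sPS sRS Ff; have [_ _ gP _] := fusP sRS sPS Fg.
have Ephi : phi = f.
  rewrite def_phi; apply/ffunP=> x; rewrite !ffunE.
  by have [/fR-> // | /f1->] := boolP (x \in P); rewrite if_same.
suff -> : img phi P = R by rewrite Ephi.
apply: group_inj; rewrite (imgE Iphi) Ephi; apply/setP=> y.
apply/imsetP/idP=> [[x Px ->] | Ry]; first exact: fR.
exists (g y); first exact: gP.
by move/ffunP/(_ y): fg; rewrite !ffunE Ry.
Qed.

Lemma img_sub P Q phi : P \subset S -> Q \subset S -> phi \in fus_Hom F P Q ->
  img phi P \subset Q.
Proof.
move=> sPS sQS Fphi; have Iphi := subsetP (fus_Hom_Inj F sPS sQS) _ Fphi.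
rewrite (imgE Iphi); apply/subsetP=> _ /imsetP[x Px ->].
by have [_ _ ->] := fusP sPS sQS Fphi.
Qed.

Lemma fus_codom P Q Q' phi : P \subset S -> Q \subset S -> Q' \subset S ->
  phi \in fus_Hom F P Q -> phi @: P \subset Q' -> phi \in fus_Hom F P Q'.
Proof.
move=> sPS sQS sQ'S Fphi sphiP; have Iphi := subsetP (fus_Hom_Inj F sPS sQS) _ Fphi.
have [Fphi' _] := fus_iso_img sPS sQS Fphi.
by apply: fus_widen Fphi'; rewrite ?(imgE Iphi).
Qed.

Lemma fus_inv P phi : P \subset S -> phi \in fus_Hom F P S ->
  exists2 psi, psi \in fus_Hom F (img phi P) P
    & {in P, cancel phi psi} /\ {in img phi P, cancel psi phi}.
Proof.
move=> sPS Fphi; have [_ [g [Fg gf fg]]] := fus_iso_img sPS (subxx S) Fphi.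
exists g => //; split=> x Xx.
  by move/ffunP/(_ x): gf; rewrite !ffunE Xx.
by move/ffunP/(_ x): fg; rewrite !ffunE Xx.
Qed.

(** This form of conjugacy quantifies over a finite set of maps only, so it can be decided when
    choosing a fully normalized conjugate. *)
Lemma fus_conjP P Q : P \subset S -> Q \subset S ->
  fus_conj F P Q <-> exists2 phi, phi \in fus_Hom F P S & img phi P = Q.
Proof.
move=> sPS sQS; split=> [[phi [Fphi [g [Fg gf fg]]]] | [phi Fphi <-]].
  have FphiS := fus_widen sPS sQS (subxx S) Fphi; exists phi => //.
  apply: group_inj; rewrite (imgE (subsetP (fus_Hom_Inj F sPS sQS) _ Fphi)).
  have [_ _ phiQ _] := fusP sPS sQS Fphi; have [_ _ gP _] := fusP sQS sPS Fg.
  apply/setP=> y; apply/imsetP/idP=> [[x Px ->] | Qy]; first exact: phiQ.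
  exists (g y); first exact: gP.
  by move/ffunP/(_ y): fg; rewrite !ffunE Qy.
by exists phi; apply: fus_iso_img Fphi.
Qed.

Lemma fus_conj_trans P Q R : P \subset S -> Q \subset S -> R \subset S ->
  fus_conj F P Q -> fus_conj F Q R -> fus_conj F P R.
Proof.
move=> sPS sQS sRS [f [Ff [f' [Ff' f'f ff']]]] [g [Fg [g' [Fg' g'g gg']]]].
have [_ _ fQ _] := fusP sPS sQS Ff; have [_ _ g'Q _] := fusP sRS sQS Fg'.
have [fM _ _ f1] := fusP sPS sQS Ff; have [_ _ _ g'1] := fusP sRS sQS Fg'.
exists (compF g f); split; first exact: fus_Hom_comp Ff Fg.
exists (compF f' g'); split; first exact: fus_Hom_comp Fg' Ff'.
  rewrite -f'f; apply/ffunP=> x; rewrite !ffunE.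
  have [Px | /f1 fx1] := boolP (x \in P).
    by move/ffunP/(_ (f x)): g'g; rewrite !ffunE fQ // => ->.
  by move/ffunP/(_ (f x)): g'g; rewrite !ffunE fx1 group1 => ->.
rewrite -gg'; apply/ffunP=> x; rewrite !ffunE.
have [Px | /g'1 fx1] := boolP (x \in R).
  by move/ffunP/(_ (g' x)): ff'; rewrite !ffunE g'Q // => ->.
by move/ffunP/(_ (g' x)): ff'; rewrite !ffunE fx1 group1 => ->.
Qed.

(** A conjugate whose normalizer in S has the largest order works, because its own conjugates are
    again conjugates of P. *)
Lemma fully_normalized_conj P : P \subset S ->
  exists R, [/\ R \subset S, fus_conj F P R & fully_normalized F R].
Proof.
move=> sPS.
pose conjb Q := [exists phi in fus_Hom F P S, img phi P == Q].
have conjbP Q : Q \subset S -> reflect (fus_conj F P Q) (conjb Q).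
  move=> sQS; apply: (iffP exists_inP) => [[phi Fphi /eqP def_Q] | ].
    by apply/fus_conjP=> //; exists phi.
  by case/fus_conjP=> // phi Fphi <-; exists phi.
pose ok (Q : {group gT}) := (Q \subset S) && conjb Q.
have okP : ok P.
  rewrite /ok sPS; apply/(conjbP P sPS); exists (idF P).
  have id_id : compF (idF P) (idF P) = idF P.
    by apply/ffunP=> x; rewrite !ffunE; case Px: (x \in P); rewrite ?Px ?group1.
  split; first exact: fus_incl.
  by exists (idF P); split=> //; apply: fus_incl.
case: (arg_maxnP (fun Q : {group gT} => #|'N_S(Q)|) okP) => R /andP[sRS /(conjbP R sRS) cPR] maxR.
exists R; split=> // Q sQS cRQ; apply: maxR; rewrite /ok sQS.
by apply/(conjbP Q sQS); apply: fus_conj_trans cRQ.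
Qed.

Lemma Aut_F_Aut P : Aut_F F P \subset Aut P.
Proof. by apply/subsetP=> a /setIdP[]. Qed.

Lemma fus_of_Aut_F P a : P \subset S -> a \in Aut_F F P ->
  restrF P a \in fus_Hom F P S.
Proof. by move=> sPS /setIdP[_ Fa]; apply: fus_widen Fa. Qed.

Lemma Aut_F_of_fus P phi : P \subset S -> phi \in fus_Hom F P S ->
  phi @: P \subset P -> exists2 a, a \in Aut_F F P & {in P, phi =1 a}.
Proof.
move=> sPS Fphi sphiP; have [phiM phi_inj _ phi1] := fusP sPS (subxx S) Fphi.
have injphi : 'injm (morphm_morphism phiM) by apply/injmP.
have imphi : morphm_morphism phiM @* P = P.
  by apply/(morphim_fixP injphi P (subxx P)); rewrite morphimEdom.
exists (aut injphi imphi); last by move=> x Px; rewrite autE.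
rewrite inE Aut_aut; suff -> : restrF P (aut injphi imphi) = phi.
  exact: fus_codom sphiP.
apply/ffunP=> x; rewrite ffunE; case: ifPn => [Px | /phi1-> //].
by rewrite autE.
Qed.

Lemma img_Aut_F P a : P \subset S -> a \in Aut_F F P -> img (restrF P a) P = P.
Proof.
move=> sPS /setIdP[Aa Fa]; apply: group_inj.
rewrite (imgE (subsetP (fus_Hom_Inj F sPS sPS) _ Fa)).
transitivity (autm Aa @* P); last exact: im_autm.
rewrite morphimEdom; apply: eq_in_imset => x Px; by rewrite ffunE Px.
Qed.

Lemma mem_Nphi P phi (g h : gT) : g \in 'N_S(P) -> h \in 'N_S(img phi P) ->
    {in P, forall x, phi x \in img phi P} ->
  {in P, forall x, phi (x ^ g) = phi x ^ h} -> g \in Nphi S P phi.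
Proof.
move=> Ng Nh phiP eq_gh; rewrite inE Ng; apply/exists_inP.
have nh : h \in 'N(img phi P) by case/setIP: Nh.
exists (conj_aut (img phi P) h); first exact: mem_morphim.
by apply/forall_inP=> x Px; rewrite norm_conj_autE ?phiP // eq_gh.
Qed.

End FusionMaps.

(** * Transport of normalizers to a fully normalized conjugate *)

Section Saturated.

Variables (p : nat) (gT : finGroupType) (S : {group gT}) (F : fusion_system S).
Hypotheses (pS : p.-group S) (satF : saturated F p).
Implicit Types (P Q R : {group gT}) (phi psi : {ffun gT -> gT}).
Implicit Types a b : {perm gT}.

Lemma Aut_F_group_Sylow R (sRS : R \subset S) : fully_normalized F R ->
  p.-Sylow(Group (Aut_F_group_set F sRS)) (Aut_S S R).
Proof. by case: satF => satI _ /(satI _ sRS)[]. Qed.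

(** By Sylow, the transport of Aut_S(Q) along [phi] can be conjugated into Aut_S(R) inside Aut_F(R).
    Correcting [phi] by the conjugating automorphism makes all of N_S(Q) satisfy the extension
    condition. Hence [psi] need not agree with [phi] on Q. *)
Lemma fully_normalized_lift Q R phi : Q \subset S -> fully_normalized F R ->
    phi \in fus_Hom F Q S -> img phi Q = R ->
  exists2 psi, psi \in fus_Hom F 'N_S(Q)%G S & psi @: Q = R.
Proof.
move=> sQS fnR Fphi def_R.
have sRS : R \subset S by rewrite -def_R (img_sub sQS (subxx S) Fphi).
have [fcR _] := satF.1 R sRS fnR; have sylR := Aut_F_group_Sylow sRS fnR.
have [phiM phi_inj phiS phi1] := fusP sQS (subxx S) Fphi.
pose f := morphm_morphism phiM.
have injf : 'injm f by apply/injmP.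
have def_fQ : (f @* Q)%G = R.
  apply: group_inj; rewrite -def_R (imgE (subsetP (fus_Hom_Inj F sQS (subxx S)) _ Fphi)).
  by rewrite /= morphimEdom.
have [phi' Fphi' [phiK phi'K]] := fus_inv sQS Fphi.
rewrite def_R in Fphi' phi'K.
have FphiR : phi \in fus_Hom F Q R.
  by rewrite -def_R; have [] := fus_iso_img sQS (subxx S) Fphi.
pose iso := Aut_isom injf (subxx Q).
have isoE a x : a \in Aut Q -> x \in Q -> iso a (phi x) = phi (a x).
  by move=> Aa Qx; apply: (Aut_isomE injf (subxx Q)).
have phiR x : x \in Q -> phi x \in R.
  by move=> Qx; have [_ _ ->] := fusP sQS sRS FphiR.
have phi'Q x : x \in R -> phi' x \in Q.
  by move=> Rx; have [_ _ ->] := fusP sRS sQS Fphi'.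
pose X := (iso @* Aut_S S Q)%G.
have AQ g : g \in 'N_S(Q) -> conj_aut Q g \in Aut Q by move=> _; apply: Aut_aut.
have isoAQ a : a \in Aut Q -> iso a \in Aut R.
  by move=> Aa; rewrite -def_fQ; apply: Aut_Aut_isom.
have sXF : X \subset Aut_F F R.
  apply/subsetP=> _ /morphimP[_ _ /morphimP[g ng Ng ->] ->].
  have Acg := AQ g Ng; have [Sg _] := setIP Ng.
  rewrite inE isoAQ //=.
  have Fcg : restrF Q (conjg^~ g) \in fus_Hom F Q Q.
    by apply: fus_conj_map; rewrite ?(normP ng).
  suff -> : restrF R (iso (conj_aut Q g)) = compF phi (compF (restrF Q (conjg^~ g)) phi').
    by apply: fus_Hom_comp FphiR => //; apply: fus_Hom_comp Fphi' Fcg.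
  apply/ffunP=> x; rewrite !ffunE; case: ifPn => [Rx | R'x].
    rewrite phi'Q // -{1}(phi'K x Rx) isoE ?phi'Q //.
    by rewrite norm_conj_autE ?phi'Q.
  have [_ _ _ ->] := fusP sRS sQS Fphi'; rewrite // group1 conj1g.
  exact/esym/(morph1 f).
have pX : p.-group X.
  rewrite morphim_pgroup // morphim_pgroup //.
  exact: pgroupS (subsetIl _ _) pS.
have [chi Fchi sXchi] := Sylow_subJ sylR sXF pX.
have Fchi' : chi^-1 \in Aut_F F R by have := groupVr Fchi.
have Achi' : chi^-1 \in Aut R by apply: (subsetP (Aut_F_Aut F R)).
pose phi2 := compF (restrF R chi^-1) phi.
have Fphi2 : phi2 \in fus_Hom F Q S.
  apply: fus_Hom_comp FphiR _ => //; exact: fus_of_Aut_F.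
have phi2E x : x \in Q -> phi2 x = chi^-1 (phi x).
  by move=> Qx; rewrite !ffunE phiR.
have im_phi2 : phi2 @: Q = R.
  apply/setP=> y; apply/imsetP/idP=> [[x Qx ->] | Ry].
    by rewrite phi2E // Aut_closed ?phiR.
  have Rchiy : chi y \in R.
    by rewrite Aut_closed //; apply: (subsetP (Aut_F_Aut F R)).
  by exists (phi' (chi y)); rewrite ?phi2E ?phi'Q // phi'K // permK.
have img2 : img phi2 Q = R by apply: group_inj; rewrite /= im_phi2 genGid.
have [|psi Fpsi psiE] := satF.2 Q phi2 sQS Fphi2; first by rewrite img2.
(* The choice of [chi] says that each c_g with g in N_S(Q), transported by [phi2], is conjugation by
   some h in N_S(R). *)
have defN : Nphi_group S Q phi2 = 'N_S(Q)%G.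
  apply: group_inj; apply/eqP; rewrite eqEsubset; apply/andP; split.
    by apply/subsetP=> g; rewrite inE => /andP[].
  apply/subsetP=> g Ng /=; have [_ ng] := setIP Ng.
  have Xg : iso (conj_aut Q g) \in X.
    by rewrite mem_morphim ?AQ //; apply: mem_morphim.
  have := subsetP sXchi _ Xg; rewrite mem_conjg => /morphimP[h nh Nh eq_h].
  apply: (mem_Nphi (h := h)) => //; rewrite ?img2 // => x Qx.
    by rewrite phi2E // Aut_closed ?phiR.
  rewrite !phi2E ?memJ_norm // -(norm_conj_autE nh) ?Aut_closed ?phiR //.
  by rewrite -eq_h permJ isoE ?AQ // norm_conj_autE.
exists psi; first by rewrite -defN.
by rewrite -im_phi2; apply: eq_in_imset.
Qed.

End Saturated.

(** * Extension of all morphisms to S in the metacyclic case *)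

Section MetacyclicFusion.

Variables (p : nat) (gT : finGroupType) (S : {group gT}) (F : fusion_system S).
Hypotheses (p_pr : prime p) (p_odd : odd p) (pS : p.-group S) (mcS : metacyclic S).
Hypothesis satF : saturated F p.
Implicit Types (P Q R T : {group gT}) (phi psi : {ffun gT -> gT}).
Implicit Types a b : {perm gT}.

Lemma Nphi_Aut_F R b g : R \subset S -> b \in Aut_F F R -> g \in 'N_S(R) ->
  conj_aut R g ^ b \in Aut_S S R -> g \in Nphi S R (restrF R b).
Proof.
move=> sRS Fb Ng /morphimP[h nh Nh eq_h]; have [_ ng] := setIP Ng.
have Ab := subsetP (Aut_F_Aut F R) b Fb.
have imgR := img_Aut_F sRS Fb.
apply: (mem_Nphi (h := h)); rewrite ?imgR // => x Rx.
  by rewrite ffunE Rx Aut_closed.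
rewrite !ffunE memJ_norm // Rx -(norm_conj_autE nh) ?Aut_closed //.
by rewrite -eq_h permJ norm_conj_autE.
Qed.

Lemma Aut_F_extends_Nphi R b : R \subset S -> fully_normalized F R -> b \in Aut_F F R ->
  exists2 psi, psi \in fus_Hom F (Nphi_group S R (restrF R b)) S & {in R, psi =1 b}.
Proof.
move=> sRS fnR Fb; have Fphi := fus_of_Aut_F sRS Fb.
have [fcR _] := satF.1 R sRS fnR.
have [|psi Fpsi psiE] := satF.2 R _ sRS Fphi; first by rewrite (img_Aut_F sRS Fb).
by exists psi => // x Rx; rewrite psiE // ffunE Rx.
Qed.

(** It suffices to find g in N_S(R) outside R whose conjugation map is sent into Aut_S(R) by [b]:
    then [b] extends to a subgroup properly containing R, where the assumption on larger subgroups
    applies. *)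
Lemma Aut_F_extends R b : R \proper S -> fully_normalized F R ->
    (forall T phi, T \subset S -> R \proper T -> phi \in fus_Hom F T S ->
       exists2 a, a \in Aut_F F S & {in T, phi =1 a}) ->
  b \in Aut_F F R -> exists2 a, a \in Aut_F F S & {in R, b =1 a}.
Proof.
move=> prRS fnR IH Fb; have sRS := proper_sub prRS.
pose G := Group (Aut_F_group_set F sRS); pose N := 'N_S(R)%G; pose P := Aut_S S R.
have sNS : N \subset S := subsetIl _ _.
have nRN : N \subset 'N(R) := subsetIr _ _.
have pN : p.-group N := pgroupS sNS pS.
have prRN : R \proper N := nilpotent_proper_norm (pgroup_nil pS) prRS.
have nsRN : R <| N by rewrite /normal proper_sub.
have sylP := Aut_F_group_Sylow satF sRS fnR.
have FJ a c : a \in Aut_F F R -> c \in Aut_F F R -> a ^ c \in Aut_F F R.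
  exact: (@groupJ _ G).
have FA a : a \in Aut_F F R -> a \in Aut R by apply: subsetP (Aut_F_Aut F R) a.
have sNphiN a : Nphi_group S R (restrF R a) \subset N.
  by apply/subsetP=> g; rewrite inE => /andP[].
have FP g : g \in N -> conj_aut R g \in Aut_F F R.
  move=> Ng; apply: (subsetP (pHall_sub sylP)); apply: mem_morphim => //.
  exact: (subsetP nRN).
have ext a g : a \in Aut_F F R -> g \in N -> g \notin R -> conj_aut R g ^ a \in P ->
    exists2 c, c \in Aut_F F S & {in R, a =1 c}.
  move=> Fa Ng R'g Pga; have [psi Fpsi psiE] := Aut_F_extends_Nphi sRS fnR Fa.
  (* For x in R, conjugating c_x by a gives c_(a x), which is again induced from R. *)
  have sRNphi : R \subset Nphi_group S R (restrF R a).
    apply/subsetP=> x Rx; have Nx := subsetP (proper_sub prRN) x Rx.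
    have Rax : a x \in R by rewrite Aut_closed ?FA.
    apply: Nphi_Aut_F => //; have <- : conj_aut R (a x) = conj_aut R x ^ a.
      apply: (eq_Aut (FA _ (FP _ _))); rewrite ?(subsetP (proper_sub prRN)) ?Aut_closed ?FA //.
        by rewrite FJ ?FP.
      move=> y Ry; rewrite -(permKV a y) permJ.
      have Ry' : a^-1 y \in R by rewrite Aut_closed ?groupV ?FA.
      have Ray' : a (a^-1 y) \in R by rewrite permKV.
      rewrite !conj_autE //.
      by rewrite -(autmE (FA a Fa)) morphJ.
    apply: (mem_morphim (conj_aut_morphism R)); first exact: (subsetP (normG R)).
    exact: (subsetP (proper_sub prRN)).
  have prR : R \proper Nphi_group S R (restrF R a).
    apply/properP; split=> //; exists g => //; exact: Nphi_Aut_F.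
  have [|c Fc psic] := IH _ psi _ prR Fpsi; first exact: subset_trans (sNphiN a) sNS.
  by exists c => // x Rx; rewrite -psiE // psic // (subsetP sRNphi).
pose triv g := [forall x in R, coset 'Phi(R) (x ^ g) == coset 'Phi(R) x].
have [/exists_inP[g Ng /andP[R'g /forall_inP tr_g]] | no_triv] :=
    boolP [exists g in N, (g \notin R) && triv g].
  (* Acting trivially on R / Phi(R) is preserved under conjugation by [b], so c_g^b lies in the
     kernel and hence in P. *)
  apply: (ext b g) => //; apply: (stab_Phi_sub_Sylow (G := G) pN nsRN (Aut_F_Aut F R) sylP).
    by rewrite FJ // FP.
  move=> x Rx; have Rx' : b^-1 x \in R by rewrite Aut_closed ?groupV ?FA.
  rewrite -{1}(permKV b x) permJ norm_conj_autE ?(subsetP nRN) //.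
  rewrite -(quo_autE (Phi_char R)) ?FA ?memJ_norm ?(subsetP nRN) //.
  by rewrite (eqP (tr_g _ Rx')) (quo_autE (Phi_char R)) ?permKV ?FA.
have [|g Ng R'g] := subsetPn (_ : ~~ (N \subset R)); first by have /andP[] := prRN.
apply: (ext b g) => //.
suff nPb : b \in 'N(P).
  by rewrite memJ_norm // mem_morphim // (subsetP nRN).
apply: (subsetP (metacyclic_Sylow_normal (G := G) p_pr p_odd pN (metacyclicS sNS mcS)
                  nsRN (Aut_F_Aut F R) sylP _ _ _)) => //; last 2 first.
- by have /andP[] := prRN.
(* When c normalizes P its extension is defined on all of N_S(R), and it maps N_S(R) to itself
   because it preserves R. *)
- move=> c /setIP[Fc nPc].
  have [psi Fpsi psiE] := Aut_F_extends_Nphi sRS fnR Fc.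
  have sNNphi : N \subset Nphi_group S R (restrF R c).
    apply/subsetP=> h Nh; apply: Nphi_Aut_F => //.
    by rewrite memJ_norm // mem_morphim // (subsetP nRN).
  have defN : Nphi_group S R (restrF R c) = N.
    by apply: group_inj; apply/eqP; rewrite eqEsubset sNphiN.
  rewrite defN in Fpsi; have [psiM psi_inj psiS _] := fusP sNS (subxx S) Fpsi.
  exists (morphm_morphism psiM); last exact: psiE.
  rewrite subsetI; apply/andP; split.
    by apply/subsetP=> _ /morphimP[h _ Nh ->]; apply: psiS.
  have <- : morphm_morphism psiM @* R = R.
    rewrite morphimEsub ?proper_sub // -[RHS](im_autm (FA c Fc)) morphimEdom.
    exact: eq_in_imset.
  exact: morphim_norms.
- move=> h Nh stab_h; apply: contraR no_triv => R'h.
  by apply/exists_inP; exists h; rewrite // R'h; apply/forall_inP=> x Rx; rewrite stab_h.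
Qed.

Lemma fus_extends Q phi : Q \subset S -> phi \in fus_Hom F Q S ->
  exists2 a, a \in Aut_F F S & {in Q, phi =1 a}.
Proof.
(* The strict bound makes the base case vacuous. *)
move: {2}(#|S| - #|Q|).+1 (ltnSn (#|S| - #|Q|)) => n.
elim: n Q phi => // n IHn Q phi ltn sQS Fphi.
have [eqQS | prQS] := eqVproper sQS.
  have eqQ : Q = S by apply: group_inj.
  rewrite eqQ in Fphi *; apply: (Aut_F_of_fus (subxx S) Fphi).
  apply/subsetP=> _ /imsetP[x Sx ->].
  by have [_ _ ->] := fusP (subxx S) (subxx S) Fphi.
(* Only the order of Q matters, so the induction hypothesis also serves for the image of Q and for
   R. *)
have IH P T psi : #|P| = #|Q| -> T \subset S -> P \proper T -> psi \in fus_Hom F T S ->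
    exists2 a, a \in Aut_F F S & {in T, psi =1 a}.
  move=> oP sTS prPT; apply: IHn => //; have := proper_card prPT; rewrite oP => ltQT.
  have := subset_leq_card sTS => leTS; rewrite -ltnS (leq_trans _ ltn) // ltnS.
  by rewrite ltn_sub2l // (leq_trans ltQT).
have [R [sRS cQR fnR]] := fully_normalized_conj F sQS.
(* The map lifts to N_S(P), which is larger than P since S is nilpotent, and then to S by
   induction. *)
have to_R P : P \subset S -> fus_conj F P R -> #|P| = #|Q| ->
    exists2 a, a \in Aut_F F S & a @: P = R.
  move=> sPS /(fus_conjP F sPS sRS)[f Ff imf] oP.
  have [psi Fpsi psiP] := fully_normalized_lift pS satF sPS fnR Ff imf.
  have prPS : P \proper S by rewrite properEcard sPS oP proper_card.
  have sPN : P \subset 'N_S(P) by rewrite subsetI sPS normG.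
  have [||a Fa psia] := IH P _ psi oP _ _ Fpsi; first exact: subsetIl.
    exact: nilpotent_proper_norm (pgroup_nil pS) prPS.
  exists a => //; rewrite -psiP; apply: eq_in_imset => x Px.
  by rewrite psia // (subsetP sPN).
have [a Fa aQ] := to_R Q sQS cQR erefl.
pose Q1 := img phi Q.
have [_ phi_inj _ _] := fusP sQS (subxx S) Fphi.
have defQ1 : Q1 = phi @: Q :> {set gT} := imgE (subsetP (fus_Hom_Inj F sQS (subxx S)) _ Fphi).
have sQ1S : Q1 \subset S := img_sub sQS (subxx S) Fphi.
have cQQ1 : fus_conj F Q Q1 by apply/fus_conjP=> //; exists phi.
have cQ1R : fus_conj F Q1 R.
  apply: fus_conj_trans cQR => //; have [f [Ff [g [Fg gf fg]]]] := cQQ1.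
  by exists g; split=> //; exists f.
have oQ1 : #|Q1| = #|Q| by rewrite defQ1 card_in_imset.
have [b Fb bQ1] := to_R Q1 sQ1S cQ1R oQ1.
have Fai : a^-1 \in Aut_F F S by rewrite (groupVr (Fa : a \in Group (Aut_F_group_set F (subxx S)))).
(* Automorphisms a and b of S carry Q and its image onto R, so phi becomes an automorphism f of R.
   If d extends f, then phi is a, followed by d, followed by b^-1. *)
pose f := compF (restrF Q1 b) (compF phi (restrF R a^-1)).
have aiQ x : x \in R -> a^-1 x \in Q.
  by rewrite -aQ => /imsetP[y Qy ->]; rewrite permK.
have phiQ1 x : x \in Q -> phi x \in Q1 by move=> Qx; rewrite defQ1 imset_f.
have bR x : x \in Q1 -> b x \in R by move=> Qx; rewrite -bQ1 imset_f.
have fE x : x \in R -> f x = b (phi (a^-1 x)).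
  by move=> Rx; rewrite !ffunE Rx phiQ1 ?aiQ.
have Ff : f \in fus_Hom F R S.
  have FR c T : c \in Aut_F F S -> T \subset S -> restrF T c \in fus_Hom F T S.
    move=> Fc sTS; have -> : restrF T c = restrF T (restrF S c).
      apply/ffunP=> x; rewrite !ffunE.
      by case: ifP => // /(subsetP sTS)->.
    by apply: (fus_restr (P := S)); rewrite ?fus_of_Aut_F.
  apply: (fus_Hom_comp (Q := Q1)) (FR _ _ _ _) => //.
  apply: (fus_Hom_comp (Q := Q)) => //; last first.
    by rewrite /Q1; have [] := fus_iso_img sQS (subxx S) Fphi.
  apply: (fus_codom sRS (subxx S)) => //; first exact: FR.
  by apply/subsetP=> _ /imsetP[x Rx ->]; rewrite ffunE Rx aiQ.
have [|c Fc fc] := Aut_F_of_fus sRS Ff.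
  by apply/subsetP=> _ /imsetP[x Rx ->]; rewrite fE ?bR ?phiQ1 ?aiQ.
have oR : #|R| = #|Q| by rewrite -aQ card_imset //; apply: perm_inj.
have [||d Fd cd] := Aut_F_extends _ fnR _ Fc.
- by rewrite properEcard sRS oR proper_card.
- by move=> T psi sTS prRT; apply: IH prRT.
have gF u v : u \in Aut_F F S -> v \in Aut_F F S -> u * v \in Aut_F F S.
  exact: (@groupM _ (Group (Aut_F_group_set F (subxx S)))).
have Fbi : b^-1 \in Aut_F F S by rewrite (groupVr (Fb : b \in Group (Aut_F_group_set F (subxx S)))).
exists (a * d * b^-1); first by rewrite !gF.
move=> x Qx; have Rax : a x \in R by rewrite -aQ imset_f.
by rewrite !permM -cd // -fc // fE // permK permK.
Qed.

End MetacyclicFusion.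

Theorem theorem4p1 (p : nat) (gT : finGroupType) (S : {group gT})
    (p_pr : prime p) (p_ge3 : (3 <= p)%N)
    (pS : (p.-group S)%g) (mS : metacyclic S) : resistant p S.
Proof.
move=> F satF Q Q' phi sQS sQ'S Fphi.
have p_odd : odd p by case: (even_prime p_pr) p_ge3 => [->|].
by apply: (fus_extends p_pr p_odd pS mS satF sQS); apply: fus_widen Fphi.
Qed.
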